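(* Let $\{X_i\}_{i=1}^{\infty}$ be a sequence of negatively associated random variables on the upper probability space $(\Omega,\mathcal{F},\mathcal{P},\mathbb{V})$ such that $\sup_{i\ge 1}\mathbb{E}[|X_i|^{\alpha+1}]<\infty$ for some constant $\alpha>0$. Let $\{a_i\}_{i=1}^{\infty}$ be a bounded sequence of positive numbers and let $\{A_n\}_{n=1}^{\infty}$ be an increasing sequence of positive numbers such that $$\lim_{n\to\infty}\frac{A_n}{n^{\frac{1}{\beta+1}}}=\infty,$$ where $\beta$ is a constant with $\beta\in(0,\min(1,\alpha))$. Then $$\mathbb{V}\left(\left\{\liminf_{n\to\infty}\frac{\sum_{i=1}^{n}a_i(X_i-\mathcal{E}[X_i])}{A_n}<0\right\}\cup\left\{\limsup_{n\to\infty}\frac{\sum_{i=1}^{n}a_i(X_i-\mathbb{E}[X_i])}{A_n}>0\right\}\right)=0,$$ and also $$v\left(\liminf_{n\to\infty}\frac{\sum_{i=1}^{n}a_i(X_i-\mathcal{E}[X_i])}{A_n}\ge 0\right)=1,\qquad v\left(\limsup_{n\to\infty}\frac{\sum_{i=1}^{n}a_i(X_i-\mathbb{E}[X_i])}{A_n}\le 0\right)=1.$$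
   Context: Let $(\Omega,\mathcal{F})$ be a measurable space and $\mathcal{P}$ a nonempty set of probability measures on it. For $A\in\mathcal{F}$ set $\mathbb{V}(A)=\sup_{P\in\mathcal{P}}P(A)$ (upper probability) and $v(A)=\inf_{P\in\mathcal{P}}P(A)$ (lower probability). For a random variable $X$ with $E_P[|X|]<\infty$ for all $P\in\mathcal{P}$ (or $X\ge 0$, with values in $[0,\infty]$ allowed for the expectation), set $\mathbb{E}[X]=\sup_{P\in\mathcal{P}}E_P[X]$ and $\mathcal{E}[X]=\inf_{P\in\mathcal{P}}E_P[X]$, where $E_P$ is the classical expectation under $P$. $(\Omega,\mathcal{F},\mathcal{P},\mathbb{V})$ is called the upper probability space. Let $C_b^+(\mathbb{R})$ be the set of nonnegative bounded continuous functions on $\mathbb{R}$. Functions have ''the same monotonicity'' if they are all nondecreasing or all nonincreasing. A sequence $\{X_i\}_{i=1}^{\infty}$ of random variables is negatively associated if for every $n\ge 1$ and every sequence $\{f_i\}_{i=1}^{\infty}\subset C_b^+(\mathbb{R})$ with the same monotonicity, $\mathbb{E}\left[\prod_{i=1}^{n+1}f_i(X_i)\right]\le \mathbb{E}\left[\prod_{i=1}^{n}f_i(X_i)\right]\,\mathbb{E}[f_{n+1}(X_{n+1})]$. *)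

(* Defs.v *)
From HB Require Import structures.
From mathcomp Require Import all_boot all_order all_algebra.
From mathcomp Require Import all_classical all_reals all_analysis.

Set Implicit Arguments.
Unset Strict Implicit.
Unset Printing Implicit Defensive.

Import Order.TTheory GRing.Theory Num.Theory.
Import numFieldNormedType.Exports.

Local Open Scope classical_set_scope.
Local Open Scope ring_scope.

(* Sequences indexed from 1 in the mathematics are indexed from 0 here: [X i],
   [a i], [A n], [f i] stand for X_{i+1}, a_{i+1}, A_{n+1}, f_{i+1}. *)

Definition upper_prob {d : measure_display} {T : measurableType d}
    {R : realType} (PP : set (probability T R)) (B : set T) : \bar R :=
  ereal_sup [set P B | P in PP].

Definition lower_prob {d : measure_display} {T : measurableType d}
    {R : realType} (PP : set (probability T R)) (B : set T) : \bar R :=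
  ereal_inf [set P B | P in PP].

Definition upper_expectation {d : measure_display} {T : measurableType d}
    {R : realType} (PP : set (probability T R)) (Y : T -> R) : \bar R :=
  ereal_sup [set 'E_P[Y]%E | P in PP].

Definition lower_expectation {d : measure_display} {T : measurableType d}
    {R : realType} (PP : set (probability T R)) (Y : T -> R) : \bar R :=
  ereal_inf [set 'E_P[Y]%E | P in PP].

Definition Cb_nneg {R : realType} : set (R -> R) :=
  [set f : R -> R | [/\ forall x, 0 <= f x, bounded_fun f & continuous f]].

Definition same_monotonicity {R : realType} (f : nat -> R -> R) : Prop :=
  (forall i, nondecreasing_fun (f i)) \/ (forall i, nonincreasing_fun (f i)).

(* The first n+1 functions in the mathematics, n >= 1, are those of index
   i < m.+2 with m = n - 1. *)
Definition negatively_associated {d : measure_display} {T : measurableType d}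
    {R : realType} (PP : set (probability T R)) (X : nat -> {mfun T >-> R}) :
    Prop :=
  forall (m : nat) (f : nat -> R -> R),
    (forall i, Cb_nneg (f i)) -> same_monotonicity f ->
    (upper_expectation PP (fun w => \prod_(i < m.+2) f i (X i w))%R <=
     upper_expectation PP (fun w => \prod_(i < m.+1) f i (X i w))%R *
     upper_expectation PP (fun w => f m.+1 (X m.+1 w))%R)%E.

(* Sum of a_i (X_i - c_i) over the first n+1 indices, divided by A_n.  The
   centerings c_i are upper or lower expectations, hence in \bar R. *)
Definition centered_avg {d : measure_display} {T : measurableType d}
    {R : realType} (X : nat -> {mfun T >-> R}) (a A : nat -> R)
    (c : nat -> \bar R) (w : T) (n : nat) : \bar R :=
  ((\sum_(i < n.+1) (a i)%:E * ((X i w)%:E - c i)) / (A n)%:E)%E.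

(* Main.v *)
Require Import Defs.
From mathcomp Require Import all_boot all_order all_algebra.
From mathcomp Require Import all_classical all_reals all_analysis.
From mathcomp Require Import measurable_realfun ring lra.
Import Order.TTheory GRing.Theory Num.Theory.
Import numFieldNormedType.Exports.
Local Open Scope classical_set_scope.
Local Open Scope ring_scope.
Set Implicit Arguments.
Unset Strict Implicit.
Unset Printing Implicit Defensive.

(** Write p = beta + 1 and q = alpha + 1.  An event has upper probability 0
exactly when every P gives it probability 0, so the theorem is an almost sure
statement under each single P.  Negative association, however, bounds only
upper expectations; hence every estimate that uses several variables at once is
made for the upper expectation and read under P afterwards.

Put Z_i = a_i (X_i - mu_i) with mu_i the upper expectation of X_i.  These are
increasing affine images of the X_i, so they are again negatively associated
([negatively_associated_comp]); they have mean at most 0 under every measure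
and uniformly bounded q-th absolute moments.  The lower half of the theorem is
the same statement for the decreasing images - a_i (X_i - nu_i), with nu_i the
lower expectation.

The heart is [negatively_associated_sum_growth]: almost surely the partial
sums of the Z_i are eventually at most C n^(1/p), with C random.  Fix r with
p < r < min(2, q) and truncate Z_i from above at b_i = i^(1/r).  By Markov the
truncation changes Z_i with probability at most K i^(-q/r), which is summable
since r < q; so almost surely it changes only finitely many terms.  For the
truncated sum S'_n take the exponential rate t = n^(-1/r), for which
t b_i <= 1 as long as i <= n.  The inequality
exp y <= 1 + y + 2 |y|^r for y <= 1, with 1 <= r <= 2, then yields
E[exp (t min(Z_i, b_i))] <= 1 + 2 K / n.  Truncation is needed only from
above, and x |-> exp (t min(x, b_i)) is a nonnegative bounded continuous
nondecreasing function: negative association applies and gives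
E[exp (t S'_n)] <= (1 + 2 K / n)^n <= exp (2 K), uniformly in n.  Chernoff at
level 2 n^(1/r) ln n gives a probability O(n^(-2)).  Two applications of the
Borel-Cantelli lemma finish, because n^(1/r) ln n = O(n^(1/p)).

Since A_n / n^(1/p) tends to infinity, dividing by A_n makes the upper limit
at most 0. *)

(** * Real analysis *)

(** Below -1 the term |y|^r dominates |y|; on [-1, 1] it dominates y^2, which
is where r <= 2 enters. *)
Lemma expR_le_1Dx_powR (R : realType) (r y : R) : 1 <= r <= 2 -> y <= 1 ->
  expR y <= 1 + y + 2 * `|y| `^ r.
Proof.
move=> /andP[r1 r2] y1.
have [ylt|yge] := ltP y (-1).
  have ey : expR y <= 1 by rewrite expR_le1; lra.
  have ny : `|y| = - y by rewrite ltr0_norm //; lra.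
  have : `|y| <= `|y| `^ r by apply: le1r_powR => //; rewrite ny; lra.
  rewrite {1}ny; lra.
have [->|y0] := eqVneq y 0.
  by rewrite expR0 normr0 powR0 ?mulr0 ?addr0// gt_eqF// (lt_le_trans _ r1).
have y2r : y ^+ 2 <= `|y| `^ r.
  rewrite -real_normK ?num_real// -powR_mulrn//; apply: ger_powR => //.
  by rewrite normr_gt0 y0 ler_norml yge.
pose z := y / 2.
(* Halving y moves it into [-1/2, 1/2], where 1 / (1 - z) is at most
   1 + z + 2 z^2; squaring this bound for exp z keeps 1 + y
   intact. *)
have e1 : expR z * (1 - z) <= 1.
  have := expR_ge1Dx (- z); rewrite -[X in _ <= X -> _]mul1r => h.
  by rewrite -[leRHS](expRxMexpNx_1 z) ler_pM2l ?expR_gt0//; lra.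
have zl : - (2^-1) <= z <= 2^-1 by rewrite /z; lra.
have e2 : expR z <= 1 + z + 2 * z ^+ 2.
  rewrite -(@ler_pM2r _ (1 - z)); last lra.
  by apply: (le_trans e1); nra.
have yz : y = 2 * z by rewrite /z; lra.
set q := `|y| `^ r in y2r *.
have e3 : expR y <= (1 + z + 2 * z ^+ 2) ^+ 2.
  by rewrite yz expRM_natl lerXn2r ?nnegrE ?expR_ge0//; nra.
apply: (le_trans e3); rewrite -subr_ge0.
have -> : 1 + y + 2 * q - (1 + z + 2 * z ^+ 2) ^+ 2 =
  2 * (q - y ^+ 2) + z ^+ 2 * (3 - 4 * z - 4 * z ^+ 2) by rewrite yz; ring.
apply: addr_ge0; first by rewrite mulr_ge0 // subr_ge0.
rewrite mulr_ge0 ?sqr_ge0//; nra.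
Qed.

(** A bound on the term of a p-series by a difference, which telescopes in the
sum.  Factoring out (x+1)^(1-s), it reduces to ln (1 + 1/x) >= 1 / (x+1). *)
Lemma powR_telescope_ge (R : realType) (s x : R) : 1 < s -> 0 < x ->
  (s - 1) / (x + 1) `^ s <= x `^ (1 - s) - (x + 1) `^ (1 - s).
Proof.
move=> s1 x0; have [y yx] : {y | y = x + 1} by exists (x + 1).
have y1 : 1 < y by rewrite yx ltrDr.
have y0 : 0 < y by exact: lt_trans y1.
have s0 : 0 < s - 1 by lra.
have yp : 0 < y `^ (1 - s) by exact: powR_gt0.
rewrite -yx.
have -> : x `^ (1 - s) = y `^ (1 - s) * expR ((s - 1) * (ln y - ln x)).
  by rewrite /powR !gt_eqF// -expRD; congr expR; ring.
have iy1 : y^-1 < 1 by rewrite invf_lt1.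
have l1 : y^-1 <= ln y - ln x.
  rewrite -(@ln_div _ y x)//.
  have -> : y / x = (1 - y^-1)^-1.
    by rewrite yx; field; rewrite -?yx ?gt_eqF//=; lra.
  have -> : ln (1 - y^-1)^-1 = - ln (1 - y^-1) by apply: lnV; rewrite posrE; lra.
  have d0 : -1 < - y^-1 by lra.
  have := le_ln1Dx d0; lra.
have -> : (y `^ s)^-1 = y `^ (1 - s) * y^-1.
  rewrite -powRN -[in RHS]powR_inv1 ?ltW// -powRD ?(gt_eqF y0) ?implybT//.
  by congr powR; ring.
rewrite mulrCA -[X in _ <= _ - X]mulr1 -mulrBr ler_pM2l//.
have := expR_ge1Dx ((s - 1) * (ln y - ln x)).
have : (s - 1) * y^-1 <= (s - 1) * (ln y - ln x) by rewrite ler_pM2l.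
lra.
Qed.

Lemma series_riemannR_bounded (R : realType) (s : R) (n : nat) : 1 < s ->
  series (riemannR s) n.+1 <= 1 + (1 - n.+1%:R `^ (1 - s)) / (s - 1).
Proof.
move=> s1; elim: n => [|n IH].
  by rewrite /series/= big_nat1 /riemannR powR1/= subrr mul0r addr0 invf_le1.
rewrite /series/= big_nat_recr//=.
apply: (le_trans (lerD IH (lexx _))); rewrite -addrA lerD2l.
rewrite -lerBrDl -mulrBl ler_pdivlMr ?subr_gt0// [_^-1 * _]mulrC.
have := @powR_telescope_ge R s n.+1%:R s1 (ltr0Sn _ _).
rewrite natr1; lra.
Qed.

Lemma nneseries_riemannR_lty (R : realType) (s : R) : 1 < s ->
  (\sum_(n <oo) (riemannR s n)%:E < +oo)%E.
Proof.
move=> s1; apply: (@le_lt_trans _ _ (1 + (s - 1)^-1)%:E); last exact: ltry.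
apply: lime_le.
  by apply: is_cvg_nneseries => n _ _; rewrite lee_fin ltW// riemannR_gt0; lra.
apply: nearW => n; rewrite sumEFin lee_fin.
have s0 : 0 < (s - 1)^-1 by rewrite invr_gt0; lra.
case: n => [|n]; first by rewrite big_geq//; lra.
apply: (le_trans (@series_riemannR_bounded R s n s1)).
by rewrite lerD2l ler_piMl ?ltW// gerBl powR_ge0.
Qed.

(** The logarithm lost in the Chernoff bound is absorbed by any positive power,
which is why r can be taken strictly above p. *)
Lemma ln_le_powR (R : realType) (k x : R) : 0 < k -> 0 < x ->
  ln x <= k^-1 * x `^ k.
Proof.
move=> k0 x0; rewrite mulrC ler_pdivlMr// mulrC -ln_powR ltW//.
by apply: ln_sublinear; exact: powR_gt0.
Qed.

(** * Upper expectations and negative association *)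

Lemma le_upper_expectation (d : measure_display) (T : measurableType d)
    (R : realType) (PP : set (probability T R)) (P : probability T R)
    (Y : T -> R) : PP P -> ('E_P[Y] <= upper_expectation PP Y)%E.
Proof. by move=> PPP; apply: ereal_sup_ubound; exists P. Qed.

Lemma upper_expectation_le (d : measure_display) (T : measurableType d)
    (R : realType) (PP : set (probability T R)) (Y : T -> R) (c : \bar R) :
  (forall P, PP P -> 'E_P[Y] <= c)%E -> (upper_expectation PP Y <= c)%E.
Proof. by move=> h; apply: ge_ereal_sup => _ [P PPP <-]; exact: h. Qed.

Lemma upper_expectation_ge0 (d : measure_display) (T : measurableType d)
    (R : realType) (PP : set (probability T R)) (Y : T -> R) : PP !=set0 ->
  (forall w, 0 <= Y w) -> (0 <= upper_expectation PP Y)%E.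
Proof.
move=> [P PPP] Y0; apply: (le_trans _ (le_upper_expectation Y PPP)).
exact: expectation_ge0.
Qed.

(** Composing with functions that all go the same way turns test functions of
the same monotonicity into test functions of the same, possibly opposite,
monotonicity.  A decreasing [g] is what reduces lower limits to upper ones. *)
Lemma negatively_associated_comp (d : measure_display) (T : measurableType d)
    (R : realType) (PP : set (probability T R)) (X Z : nat -> {mfun T >-> R})
    (g : nat -> R -> R) :
  negatively_associated PP X -> (forall i, continuous (g i)) ->
  same_monotonicity g -> (forall i w, Z i w = g i (X i w)) ->
  negatively_associated PP Z.
Proof.
move=> NA gc gm ZE m f fC fm.
have := NA m (fun i => f i \o g i) _ _.
have -> : (fun w => \prod_(i < m.+2) f i (Z i w)) =
    (fun w => \prod_(i < m.+2) (f i \o g i) (X i w)).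
  by apply/funext => w; apply: eq_bigr => i _; rewrite ZE.
have -> : (fun w => \prod_(i < m.+1) f i (Z i w)) =
    (fun w => \prod_(i < m.+1) (f i \o g i) (X i w)).
  by apply/funext => w; apply: eq_bigr => i _; rewrite ZE.
have -> : (fun w => f m.+1 (Z m.+1 w)) =
    (fun w => (f m.+1 \o g m.+1) (X m.+1 w)).
  by apply/funext => w; rewrite ZE.
apply.
  move=> i; have [f0 [M [Mr fb]] fc] := fC i; split.
  - by move=> x; exact: f0.
  - by exists M; split => // N MN x _; exact: (fb N MN (g i x)).
  - by move=> x; apply: continuous_comp; [exact: gc|exact: fc].
case: fm => fm; case: gm => gm.
- by left => i x y xy; apply: fm; exact: gm.
- by right => i x y xy; apply: fm; exact: gm.
- by right => i x y xy; apply: fm; exact: gm.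
- by left => i x y xy; apply: fm; exact: gm.
Qed.

(** Iterating the two-factor inequality splits off one variable at a time, and
the factors are nonnegative, so the bounds multiply. *)
Lemma negatively_associated_prod_le (d : measure_display)
    (T : measurableType d) (R : realType) (PP : set (probability T R))
    (Z : nat -> {mfun T >-> R}) (f : nat -> R -> R) (c : R) (m : nat) :
  PP !=set0 -> negatively_associated PP Z ->
  (forall i, Cb_nneg (f i)) -> same_monotonicity f ->
  (forall i, (i <= m)%N ->
    (upper_expectation PP (fun w => f i (Z i w)) <= c%:E)%E) ->
  (upper_expectation PP (fun w => \prod_(i < m.+1) f i (Z i w))%R
    <= (c ^+ m.+1)%:E)%E.
Proof.
move=> PP0 NA fC fm.
have f0 i x : 0 <= f i x by have [] := fC i.
elim: m => [|m IH] fc.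
  rewrite expr1; have := fc 0%N (leqnn _).
  by under [in X in _ -> X]eq_fun do rewrite big_ord1.
apply: (le_trans (NA m f fC fm)); rewrite exprSr EFinM.
apply: lee_pmul.
- by apply: upper_expectation_ge0 => // w; apply: prodr_ge0.
- exact: upper_expectation_ge0.
- by apply: IH => i im; apply: fc; exact: leqW.
- exact: fc.
Qed.

(** * Moments, tails and the Borel-Cantelli lemma *)

(** Truncating from above only is enough: the linear term is bounded by [t * Z],
whose mean is nonpositive, so the truncation introduces no bias to control. *)
Lemma expectation_expR_truncated_le (d : measure_display)
    (T : measurableType d) (R : realType) (P : probability T R)
    (Z : {mfun T >-> R}) (r t b K : R) :
  1 <= r <= 2 -> 0 <= t -> 0 <= b -> t * b <= 1 ->
  P.-integrable setT (EFin \o Z) ->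
  ('E_P[Z] <= 0)%E -> ('E_P[(fun w => `|Z w| `^ r)%R] <= K%:E)%E ->
  ('E_P[(fun w => expR (t * Num.min (Z w) b))%R]
    <= (1 + 2 * t `^ r * K)%:E)%E.
Proof.
move=> r12 t0 b0 tb iZ Z0 ZK.
pose H w := `|Z w| `^ r.
have mH : measurable_fun setT H.
  apply: (measurableT_comp (measurable_powR r)).
  exact: measurableT_comp.
have iH : P.-integrable setT (EFin \o H).
  apply/integrableP; split; first exact/measurable_EFinP.
  apply: (@le_lt_trans _ _ K%:E); last exact: ltry.
  apply: (le_trans _ ZK); rewrite unlock; apply: ge0_le_integral => //=.
  - exact/measurable_EFinP/measurableT_comp.
  - exact/measurable_EFinP.
  - by move=> w _; rewrite lee_fin ger0_norm// powR_ge0.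
pose G := ((cst 1%:E \+ (fun w => t%:E * (EFin \o Z) w)) \+
  (fun w => (2 * t `^ r)%:E * (EFin \o H) w))%E.
have i1 : P.-integrable setT (cst 1%:E) by exact: finite_measure_integrable_cst.
have i2 := integrableZl measurableT t iZ.
have i3 := integrableZl measurableT (2 * t `^ r) iH.
have i12 := integrableD measurableT i1 i2.
have iG : P.-integrable setT G := integrableD measurableT i12 i3.
have tr0 : 0 <= 2 * t `^ r by rewrite mulr_ge0// powR_ge0.
have le_G w : ((expR (t * Num.min (Z w) b))%:E <= G w)%E.
  rewrite /G /= -!EFinM -!EFinD lee_fin.
  set y := t * Num.min (Z w) b.
  have y1 : y <= 1 by rewrite (le_trans _ tb)// ler_wpM2l// ge_min lexx orbT.
  have yZ : y <= t * Z w by rewrite ler_wpM2l// ge_min lexx.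
  have ny : `|y| <= t * `|Z w|.
    rewrite normrM (ger0_norm t0) ler_wpM2l// /Num.min; case: ifPn => //.
    rewrite -leNgt => bZ; rewrite !ger0_norm//; exact: le_trans bZ.
  apply: (le_trans (expR_le_1Dx_powR r12 y1)).
  apply: lerD; first by rewrite lerD2l.
  rewrite -mulrA ler_pM2l// /H -powRM//.
  by rewrite ge0_ler_powR ?nnegrE ?mulr_ge0//; case/andP: r12; lra.
have eG : (\int[P]_w G w = 1 + t%:E * 'E_P[Z] + (2 * t `^ r)%:E * 'E_P[H])%E.
  rewrite integralD// integralD// !integralZl//.
  by have := expectation_cst P 1; rewrite unlock => ->.
apply: (@le_trans _ _ (\int[P]_w G w)%E).
  rewrite unlock; apply: ge0_le_integral => //=.
  - apply/measurable_EFinP; apply: measurableT_comp => //.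
    by apply: measurable_funM => //; exact: measurable_minr.
  - exact: measurable_int iG.
rewrite eG EFinD (EFinM (2 * t `^ r)); apply: leeD.
  by rewrite -[leRHS]adde0 leeD2l// mule_ge0_le0 ?lee_fin.
by rewrite lee_wpmul2l// lee_fin.
Qed.

Lemma expectation_powR_le_1D (d : measure_display) (T : measurableType d)
    (R : realType) (P : probability T R) (Z : {mfun T >-> R}) (r q : R) :
  0 <= r <= q ->
  ('E_P[(fun w => `|Z w| `^ r)%R] <= 1 + 'E_P[(fun w => `|Z w| `^ q)%R])%E.
Proof.
move=> /andP[r0 rq].
have mp s : measurable_fun setT (fun w => `|Z w| `^ s).
  apply: (measurableT_comp (measurable_powR s)).
  exact: measurableT_comp.
have := expectation_cst P 1; rewrite unlock => <-.
rewrite -ge0_integralD//=; last exact/measurable_EFinP.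
apply: ge0_le_integral => //=.
- exact/measurable_EFinP.
- apply/measurable_EFinP; exact: measurable_funD.
move=> w _; rewrite -EFinD lee_fin.
have [Z1|Z1] := leP 1 `|Z w|.
  by apply: (le_trans (ler_powR Z1 rq)); rewrite lerDr.
apply: (@le_trans _ _ 1); last by rewrite lerDl powR_ge0.
by rewrite -[leRHS](congr1 (@^~ r) (@powR1 R)) ge0_ler_powR// ?nnegrE// ltW.
Qed.

Lemma integrable_expectation_powR (d : measure_display) (T : measurableType d)
    (R : realType) (P : probability T R) (Z : {mfun T >-> R}) (q : R) :
  1 <= q -> ('E_P[(fun w => `|Z w| `^ q)%R] < +oo)%E ->
  P.-integrable setT (EFin \o Z).
Proof.
move=> q1 Zq; apply/integrableP; split; first exact/measurable_EFinP.
have h : (0 <= (1:R) <= q) by rewrite ler01.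
move: Zq; have := expectation_powR_le_1D P Z h; rewrite !unlock.
under eq_integral do rewrite powRr1//.
by move=> /le_lt_trans le_lt Zq; apply: le_lt; rewrite lte_add_pinfty// ltry.
Qed.

Lemma Borel_Cantelli_riemannR (d : measure_display) (T : measurableType d)
    (R : realType) (P : probability T R) (F : (set T)^nat) (C s : R) :
  1 < s -> 0 <= C -> (forall n, measurable (F n)) ->
  (forall n, P (F n) <= (C * riemannR s n)%:E)%E ->
  {ae P, forall w, \forall n \near \oo, ~ F n w}.
Proof.
move=> s1 C0 mF PF.
have rs0 n : 0 <= riemannR s n by rewrite ltW// riemannR_gt0//; lra.
have h : (\sum_(n <oo) P (F n) < +oo)%E.
  apply: (@le_lt_trans _ _ (\sum_(n <oo) C%:E * (riemannR s n)%:E)%E).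
    by apply: lee_nneseries => n _; rewrite ?measure_ge0// -EFinM.
  rewrite nneseriesZl//; last by move=> n _; rewrite lee_fin.
  by rewrite lte_mul_pinfty// nneseries_riemannR_lty.
exists (lim_sup_set F); split.
- apply: bigcapT_measurable => k; apply: bigcup_measurable => j _; exact: mF.
- exact: lim_sup_set_cvg0.
move=> w /= nF n _; apply: contra_notP nF => nF.
by exists n => // k nk Fk; apply: nF; exists k.
Qed.

(** The q-th power of the threshold is a power q/r of the index, so Markov's
inequality gives the term of a convergent series when r < q. *)
Lemma probability_ge_root_le (d : measure_display) (T : measurableType d)
    (R : realType) (P : probability T R) (Z : {mfun T >-> R}) (q r K : R)
    (i : nat) : 0 < r -> 0 <= q ->
  ('E_P[(fun w => `|Z w| `^ q)%R] <= K%:E)%E ->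
  (P [set w | i.+1%:R `^ r^-1 <= Z w]%R <= (K * riemannR (q / r) i)%:E)%E.
Proof.
move=> r0 q0 ZK; set b := i.+1%:R `^ r^-1.
have b0 : 0 < b by exact: powR_gt0.
have -> : riemannR (q / r) i = (b `^ q)^-1.
  by rewrite /riemannR /b -powRrM mulrC.
rewrite EFinM lee_pdivlMr ?powR_gt0// muleC; apply: (le_trans _ ZK).
have := @markov _ _ _ P Z (@powR R ^~ q) b b0 (measurable_powR q)
  (fun x _ => powR_ge0 x q) (ge0_ler_powR q0).
apply: le_trans; rewrite lee_wpmul2l ?lee_fin ?powR_ge0//.
apply: le_measure; rewrite ?inE.
- rewrite -[X in measurable X]setTI; exact: measurable_fun_le.
- rewrite -[X in measurable X]setTI; apply: emeasurable_fun_le => //.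
  by apply: measurableT_comp => //; exact/measurable_EFinP.
by move=> w /= bZ; rewrite lee_fin (le_trans bZ)// ler_norm.
Qed.

(** Here the scales fit: at rate [t = n^(-1/r)] each factor is at most
[1 + 2 K / n], so the product of [n] of them is bounded independently of [n],
and [t] times the threshold is [2 ln n], whence the factor [n^(-2)]. *)
Lemma truncated_sum_tail (d : measure_display) (T : measurableType d)
    (R : realType) (PP : set (probability T R)) (Z : nat -> {mfun T >-> R})
    (r K : R) (P : probability T R) (n : nat) :
  PP P -> negatively_associated PP Z -> 1 <= r <= 2 ->
  (forall i P, PP P -> P.-integrable setT (EFin \o Z i)) ->
  (forall i P, PP P -> 'E_P[Z i] <= 0)%E ->
  (forall i P, PP P -> 'E_P[(fun w => `|Z i w| `^ r)%R] <= K%:E)%E ->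
  (P [set w | 2 * ln n.+1%:R * n.+1%:R `^ r^-1 <=
     \sum_(i < n.+1) Num.min (Z i w) (i.+1%:R `^ r^-1)]%R
   <= (expR (2 * K) * riemannR 2 n)%:E)%E.
Proof.
move=> PPP NA r12 iZ Z0 ZK.
have r0 : 0 < r by case/andP: r12; lra.
have K0 : 0 <= K.
  rewrite -lee_fin; apply: (le_trans _ (ZK n P PPP)).
  by apply: expectation_ge0 => w; exact: powR_ge0.
pose b i : R := i.+1%:R `^ r^-1.
have b0 i : 0 < b i by exact: powR_gt0.
pose t := (b n)^-1.
have t0 : 0 < t by rewrite invr_gt0.
have tr : t `^ r = n.+1%:R^-1.
  by rewrite /t /b -powRN -powRrM mulNr mulVf ?gt_eqF// powR_inv1.
(* For i > n the exponent may exceed 1, but f i must still be a legitimate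
   test function, since negative association quantifies over all of f. *)
pose f i x := expR (t * Num.min x (b i)).
have fC i : Cb_nneg (f i).
  split.
  - by move=> x; exact: expR_ge0.
  - exists (expR (t * b i)); split; first exact: num_real.
    move=> M /ltW bM x _ /=; rewrite ger0_norm ?expR_ge0//; apply: le_trans bM.
    by rewrite ler_expR ler_pM2l// ge_min lexx orbT.
  - move=> x; apply: continuous_comp; last exact: continuous_expR.
    apply: continuousM; first exact: cvg_cst.
    by apply: continuous_min; [exact: cvg_id|exact: cvg_cst].
have fm : same_monotonicity f.
  left => i x y xy; rewrite ler_expR ler_pM2l//.
  by rewrite le_min !ge_min xy lexx orbT.
have f1 i : (i <= n)%N ->
    (upper_expectation PP (fun w => f i (Z i w)) <= (1 + 2 * K / n.+1%:R)%:E)%E.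
  move=> ni; apply: upper_expectation_le => Q PPQ.
  have tb : t * b i <= 1.
    rewrite mulrC ler_pdivrMr// mul1r.
    by rewrite ge0_ler_powR ?nnegrE ?ler_nat// invr_ge0 ltW.
  have := expectation_expR_truncated_le r12 (ltW t0) (ltW (b0 i)) tb
    (iZ i Q PPQ) (Z0 i Q PPQ) (ZK i Q PPQ).
  by rewrite tr mulrAC.
have := negatively_associated_prod_le (ex_intro _ P PPP) NA fC fm f1.
set S := fun w => \sum_(i < n.+1) Num.min (Z i w) (b i).
have -> : (fun w => \prod_(i < n.+1) f i (Z i w)) = (fun w => expR (S w * t)).
  apply/funext => w; rewrite mulrC mulr_sumr expR_sum.
  by apply: eq_bigr.
move=> /(le_trans (le_upper_expectation _ PPP)) ES.
have mS : measurable_fun setT S.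
  by apply: measurable_sum => i; exact: measurable_minr.
pose Sm : {mfun T >-> R} := mfun_Sub (mem_set mS).
have := @chernoff _ _ _ P Sm t (2 * ln n.+1%:R * b n) t0.
move=> /le_trans; apply; rewrite EFinM.
apply: lee_pmul.
- by apply: expectation_ge0 => w; exact: expR_ge0.
- by rewrite lee_fin expR_ge0.
- apply: (le_trans ES); rewrite lee_fin.
  have -> : expR (2 * K) = expR (2 * K / n.+1%:R) ^+ n.+1.
    by rewrite -expRM_natl; congr expR; rewrite [RHS]mulrC divfK// pnatr_eq0.
  rewrite lerXn2r ?nnegrE ?expR_ge0 ?expR_ge1Dx//.
  by rewrite addr_ge0// divr_ge0// mulr_ge0.
- rewrite lee_fin /riemannR /powR pnatr_eq0/= -expRN ler_expR lerN2.
  by rewrite /t [leRHS]mulrC mulfK ?gt_eqF.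
Qed.

(** * Almost sure growth of the partial sums *)

(** The pathwise part: only finitely many terms exceed their truncation level,
so truncating costs a bounded amount, which a positive power of [n]
absorbs. *)
Lemma truncated_sum_le_root (R : realType) (z : R^nat) (p r : R) :
  0 < p < r ->
  (\forall n \near \oo, ~ (2 * ln n.+1%:R * n.+1%:R `^ r^-1 <=
     \sum_(i < n.+1) Num.min (z i) (i.+1%:R `^ r^-1))) ->
  (\forall i \near \oo, ~ (i.+1%:R `^ r^-1 <= z i)) ->
  exists C, \forall n \near \oo,
    \sum_(i < n.+1) z i <= C * n.+1%:R `^ p^-1.
Proof.
move=> /andP[p0 pr] [N1 _ H1] [N2 _ H2].
have r0 : 0 < r by exact: lt_trans pr.
pose k := p^-1 - r^-1.
have k0 : 0 < k by rewrite subr_gt0 ltf_pV2.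
(* The excess over the truncation level vanishes from index N2 on. *)
pose e i := z i - Num.min (z i) (i.+1%:R `^ r^-1).
have e0 i : 0 <= e i by rewrite subr_ge0 ge_min lexx.
pose D := \sum_(i < N2) e i.
have D0 : 0 <= D by exact: sumr_ge0.
exists (D + 2 * k^-1); exists (maxn N1 N2) => // n /=.
rewrite geq_max => /andP[N1n N2n].
have n1 : 1 <= n.+1%:R :> R by rewrite ler1n.
have zE : \sum_(i < n.+1) z i =
    \sum_(i < n.+1) Num.min (z i) (i.+1%:R `^ r^-1) + \sum_(i < n.+1) e i.
  by rewrite -big_split/=; apply: eq_bigr => i _; rewrite /e addrC subrK.
have eD : \sum_(i < n.+1) e i = D.
  rewrite /D -!(big_mkord xpredT e) (big_cat_nat (n := N2))//=; last exact: leqW.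
  rewrite -[RHS]addr0; congr (_ + _).
  rewrite big_nat_cond big1// => i /andP[/andP[N2i _] _].
  rewrite /e min_l ?subrr// ltW// ltNge; apply/negP; exact: H2.
have h1 : \sum_(i < n.+1) Num.min (z i) (i.+1%:R `^ r^-1) <=
    2 * ln n.+1%:R * n.+1%:R `^ r^-1.
  by rewrite ltW// ltNge; apply/negP; exact: H1.
rewrite zE eD mulrDl addrC; apply: lerD.
  rewrite ler_peMr//.
  by rewrite -[leLHS](powRr0 (n.+1%:R : R)) ler_powR// invr_ge0 ltW.
apply: (le_trans h1).
have -> : n.+1%:R `^ p^-1 = n.+1%:R `^ k * n.+1%:R `^ r^-1.
  by rewrite -powRD ?pnatr_eq0 ?implybT// subrK.
rewrite mulrA ler_pM2r ?powR_gt0// -mulrA ler_pM2l//.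
exact: ln_le_powR.
Qed.

(** A one-sided law of Marcinkiewicz-Zygmund type under negative association.
The mean condition is required of every measure in [PP], because the
exponential moment is bounded as an upper expectation, and only the conclusion
is about the given [P]. *)
Lemma negatively_associated_sum_growth (d : measure_display)
    (T : measurableType d) (R : realType) (PP : set (probability T R))
    (Z : nat -> {mfun T >-> R}) (p q K : R) (P : probability T R) :
  PP P -> negatively_associated PP Z -> 1 <= p < Num.min 2 q ->
  (forall i P, PP P -> 'E_P[Z i] <= 0)%E ->
  (forall i P, PP P -> 'E_P[(fun w => `|Z i w| `^ q)%R] <= K%:E)%E ->
  {ae P, forall w, exists C, \forall n \near \oo,
    \sum_(i < n.+1) Z i w <= C * n.+1%:R `^ p^-1}.
Proof.
move=> PPP NA /andP[p1]; rewrite lt_min => /andP[p2 pq] Z0 ZK.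
(* The midpoint: r > p pays for the logarithm, r < q for the truncation,
   r <= 2 for the exponential inequality. *)
pose r := (p + Num.min 2 q) / 2.
have [pr r2 rq] : [/\ p < r, r <= 2 & r < q].
  rewrite /r /Num.min; case: ifPn => [q2|]; last rewrite -leNgt => q2.
    by split; lra.
  by split; lra.
have K0 : 0 <= K.
  rewrite -lee_fin; apply: (le_trans _ (ZK 0%N P PPP)).
  by apply: expectation_ge0 => w; exact: powR_ge0.
have iZ i Q : PP Q -> Q.-integrable setT (EFin \o Z i).
  move=> PPQ; apply: (@integrable_expectation_powR _ _ _ _ _ q); first lra.
  by apply: (le_lt_trans (ZK i Q PPQ)); exact: ltry.
have Zr i Q : PP Q -> ('E_Q[(fun w => `|Z i w| `^ r)%R] <= (1 + K)%:E)%E.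
  move=> PPQ; apply: (@le_trans _ _ (1 + 'E_Q[(fun w => `|Z i w| `^ q)%R])%E).
    by apply: expectation_powR_le_1D; apply/andP; split; lra.
  by rewrite EFinD leeD2l// ZK.
have r12 : 1 <= r <= 2 by apply/andP; split; lra.
have mmin i : measurable_fun setT (fun w => Num.min (Z i w) (i.+1%:R `^ r^-1)).
  exact: measurable_minr.
have ae1 := @Borel_Cantelli_riemannR _ _ _ P (fun n =>
  [set w | 2 * ln n.+1%:R * n.+1%:R `^ r^-1 <=
     \sum_(i < n.+1) Num.min (Z i w) (i.+1%:R `^ r^-1)]%R)
  (expR (2 * (1 + K))) 2 _ (expR_ge0 _) _
  (fun n => truncated_sum_tail n PPP NA r12 iZ Z0 Zr).
have ae2 := @Borel_Cantelli_riemannR _ _ _ P (fun i =>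
  [set w | i.+1%:R `^ r^-1 <= Z i w]%R) K (q / r) _ K0 _
  (fun i => probability_ge_root_le i _ _ (ZK i P PPP)).
apply: filterS2 (ae1 _ _) (ae2 _ _ _ _).
- by move=> w; apply: truncated_sum_le_root; apply/andP; split; lra.
- by rewrite ltr1n.
- move=> n; rewrite -[X in measurable X]setTI; apply: measurable_fun_le => //.
  exact: measurable_sum.
- by rewrite ltr_pdivlMr ?mul1r//; lra.
- by move=> n; rewrite -[X in measurable X]setTI; exact: measurable_fun_le.
- lra.
- lra.
Qed.

(** * From growth to upper limits *)

Lemma limn_esup_le0_of_le_powR (R : realType) (S A : R^nat) (C s : R) :
  (forall n, 0 < A n) ->
  (A n / n.+1%:R `^ s) @[n --> \oo] --> +oo ->
  (\forall n \near \oo, S n <= C * n.+1%:R `^ s) ->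
  (limn_esup (fun n => (S n / A n)%:E) <= 0)%E.
Proof.
move=> A0 Alim SC; apply/lee_addgt0Pr => e e0; rewrite add0e.
rewrite /limn_esup limf_esupE.
set V := [set n | S n / A n <= e].
apply: (@le_trans _ _ (ereal_sup ((fun n => (S n / A n)%:E) @` V))).
  apply: ereal_inf_lbound; exists V => //.
  have Cbig : \forall n \near \oo, C / e <= A n / n.+1%:R `^ s.
    by have /cvgryPge := Alim; apply.
  apply: filterS2 SC Cbig => n Sn.
  rewrite /V/= ler_pdivlMr ?powR_gt0// ler_pdivrMr// mulrAC ler_pdivrMr//.
  by rewrite [A n * e]mulrC; exact: le_trans.
by apply: ge_ereal_sup => _ [n Vn <-]; rewrite lee_fin.
Qed.

Lemma expectation_affine (d : measure_display) (T : measurableType d)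
    (R : realType) (P : probability T R) (X : {mfun T >-> R}) (s mu : R) :
  P.-integrable setT (EFin \o X) ->
  ('E_P[(fun w => s * (X w - mu))%R] = (s * (fine 'E_P[X] - mu))%:E)%E.
Proof.
move=> iX.
have fX : 'E_P[X]%E \is a fin_num by rewrite unlock; exact: integrable_fin_num.
have i1 : P.-integrable setT (EFin \o cst mu).
  exact: finite_measure_integrable_cst.
rewrite EFinM EFinB fineK// -[in RHS](expectation_cst P mu).
rewrite !unlock -integralB_EFin// -integralZl//.
exact: integrableB.
Qed.

(** The constant comes from |x - mu| <= 2 max(|x|, |mu|). *)
Lemma expectation_powR_affine_le (d : measure_display) (T : measurableType d)
    (R : realType) (P : probability T R) (X : {mfun T >-> R})
    (s mu D m q M : R) :
  0 <= q -> `|s| <= D -> `|mu| <= m ->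
  ('E_P[(fun w => `|X w| `^ q)%R] <= M%:E)%E ->
  ('E_P[(fun w => `|s * (X w - mu)| `^ q)%R]
    <= ((2 * D) `^ q * (M + m `^ q))%:E)%E.
Proof.
move=> q0 sD mum XM.
have D0 : 0 <= D by exact: le_trans sD.
have m0 : 0 <= m by exact: le_trans mum.
have mX : measurable_fun setT (fun w => (`|X w| `^ q)%R).
  apply: (measurableT_comp (measurable_powR q)).
  exact: measurableT_comp.
have mXm : measurable_fun setT (fun w => (`|X w| `^ q + m `^ q)%R).
  exact: measurable_funD.
have pointwise w : `|s * (X w - mu)| `^ q
    <= (2 * D) `^ q * (`|X w| `^ q + m `^ q).
  apply: (@le_trans _ _ ((2 * D * Num.max `|X w| m) `^ q)).
    rewrite ge0_ler_powR ?nnegrE ?mulr_ge0 ?le_max ?normr_ge0//.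
    rewrite normrM mulrAC mulrC ler_pM//.
    apply: (le_trans (ler_normB _ _)).
    have : `|X w| <= Num.max `|X w| m by rewrite le_max lexx.
    have : m <= Num.max `|X w| m by rewrite le_max lexx orbT.
    lra.
  rewrite powRM ?mulr_ge0 ?le_max ?normr_ge0// ler_wpM2l ?powR_ge0//.
  by rewrite /Num.max; case: ifPn => _; rewrite ?lerDr ?lerDl powR_ge0.
apply: (@le_trans _ _
    ('E_P[(fun w => (2 * D) `^ q * (`|X w| `^ q + m `^ q))%R])%E).
  rewrite unlock; apply: ge0_le_integral => //=.
  - apply/measurable_EFinP; apply: (measurableT_comp (measurable_powR q)).
    apply: measurableT_comp => //; apply: measurable_funM => //.
    exact: measurable_funB.
  - by apply/measurable_EFinP; exact: measurable_funM.
  - by move=> w _; rewrite lee_fin.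
have -> : ('E_P[(fun w => (2 * D) `^ q * (`|X w| `^ q + m `^ q))%R] =
    ((2 * D) `^ q)%:E * ('E_P[(fun w => `|X w| `^ q)%R] + (m `^ q)%:E))%E.
  rewrite -[X in (_ * (_ + X))%E](expectation_cst P) !unlock.
  rewrite -ge0_integralD//=; last by move=> w _; rewrite lee_fin powR_ge0.
    rewrite -ge0_integralZl//.
    - exact/measurable_EFinP.
    - by move=> w _; rewrite -EFinD lee_fin addr_ge0// powR_ge0.
    - by rewrite lee_fin powR_ge0.
  exact/measurable_EFinP.
by rewrite EFinM lee_wpmul2l ?lee_fin ?powR_ge0// EFinD leeD2r.
Qed.

(** The common form of the two halves of the theorem: [s = a] with [mu] the upper
expectations, and [s = - a] with [mu] the lower ones. *)
Lemma ae_limn_esup_affine_sum_le0 (d : measure_display)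
    (T : measurableType d) (R : realType) (PP : set (probability T R))
    (X : nat -> {mfun T >-> R}) (s mu A : R^nat) (p q M D m : R)
    (P : probability T R) :
  PP P -> negatively_associated PP X -> 1 <= p < Num.min 2 q ->
  (forall i P, PP P -> 'E_P[(fun w => `|X i w| `^ q)%R] <= M%:E)%E ->
  (forall i, 0 <= s i) \/ (forall i, s i <= 0) ->
  (forall i, `|s i| <= D) -> (forall i, `|mu i| <= m) ->
  (forall i P, PP P -> s i * (fine 'E_P[X i]%E - mu i) <= 0) ->
  (forall n, 0 < A n) ->
  (A n / n.+1%:R `^ p^-1) @[n --> \oo] --> +oo ->
  {ae P, forall w, (limn_esup
    (fun n => ((\sum_(i < n.+1) s i * (X i w - mu i)) / A n)%:E) <= 0)%E}.
Proof.
move=> PPP NA p1q XM ssgn sD mum smu A0 Alim.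
have q1 : 1 <= q by move: p1q; rewrite lt_min => /and3P[]; lra.
have mZ i : measurable_fun setT (fun w => s i * (X i w - mu i)).
  by apply: measurable_funM => //; exact: measurable_funB.
pose Z i : {mfun T >-> R} := mfun_Sub (mem_set (mZ i)).
have iX i Q : PP Q -> Q.-integrable setT (EFin \o X i).
  move=> PPQ; apply: (integrable_expectation_powR q1).
  by apply: (le_lt_trans (XM i Q PPQ)); exact: ltry.
have NAZ : negatively_associated PP Z.
  apply: (negatively_associated_comp (g := fun i x => s i * (x - mu i)) NA) => //.
  - move=> i x; apply: cvgM; first exact: cvg_cst.
    by apply: cvgB; [exact: cvg_id|exact: cvg_cst].
  - case: ssgn => s0; [left|right] => i x y xy.
    + by rewrite ler_wpM2l// lerD2r.
    + by rewrite ler_wnM2l// lerD2r.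
have EZ i Q : PP Q -> ('E_Q[Z i] <= 0)%E.
  move=> PPQ; rewrite (expectation_affine (s i) (mu i) (iX i Q PPQ)) lee_fin.
  exact: smu.
have ZK i Q : PP Q -> ('E_Q[(fun w => `|Z i w| `^ q)%R]
    <= ((2 * D) `^ q * (M + m `^ q))%:E)%E.
  move=> PPQ; apply: expectation_powR_affine_le => //; first lra.
  exact: XM.
have := negatively_associated_sum_growth PPP NAZ p1q EZ ZK.
by apply: filterS => w [C]; exact: limn_esup_le0_of_le_powR.
Qed.

(** * Upper and lower probabilities *)

Lemma upper_prob_eq0 (d : measure_display) (T : measurableType d)
    (R : realType) (PP : set (probability T R)) (B : set T) : PP !=set0 ->
  (forall P, PP P -> P B = 0%E) -> upper_prob PP B = 0%E.
Proof.
move=> [P PPP] PB; rewrite /upper_prob (_ : [set _ | _ in _] = [set 0%E]).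
  exact: ereal_sup1.
apply/seteqP; split => [_ [Q PPQ <-]|_ ->]; first exact: PB.
by exists P => //; exact: PB.
Qed.

Lemma lower_prob_eq1 (d : measure_display) (T : measurableType d)
    (R : realType) (PP : set (probability T R)) (B : set T) : PP !=set0 ->
  (forall P, PP P -> P B = 1%E) -> lower_prob PP B = 1%E.
Proof.
move=> [P PPP] PB; rewrite /lower_prob (_ : [set _ | _ in _] = [set 1%E]).
  exact: ereal_inf1.
apply/seteqP; split => [_ [Q PPQ <-]|_ ->]; first exact: PB.
by exists P => //; exact: PB.
Qed.

Lemma abse_expectation_le (d : measure_display) (T : measurableType d)
    (R : realType) (P : probability T R) (X : {mfun T >-> R}) (q M : R) :
  1 <= q -> ('E_P[(fun w => `|X w| `^ q)%R] <= M%:E)%E ->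
  (`|'E_P[X]| <= (1 + M)%:E)%E.
Proof.
move=> q1 XM; have q1' : 0 <= (1 : R) <= q by rewrite ler01.
have := expectation_powR_le_1D P X q1'.
have -> : (fun w => `|X w| `^ 1) = (fun w => `|X w|).
  by apply/funext => w; rewrite powRr1.
move=> X1; apply: (@le_trans _ _ (1 + 'E_P[(fun w => `|X w| `^ q)%R])%E).
  apply: le_trans X1; rewrite !unlock.
  by apply: (le_trans (le_abse_integral _ _ _)) => //; exact/measurable_EFinP.
by rewrite EFinD leeD2l.
Qed.

Lemma lee_abs_EFin (R : realType) (x : \bar R) (m : R) :
  (`|x| <= m%:E)%E = (- m%:E <= x <= m%:E)%E.
Proof.
by case: x => [r| |]; rewrite /= ?lee_fin ?ler_norml ?leye_eq ?leeNy_eq ?andbF.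
Qed.

(** Finite centerings bring the extended-real averages back to real ones. *)
Lemma centered_avgE (d : measure_display) (T : measurableType d)
    (R : realType) (X : nat -> {mfun T >-> R}) (a A mu : R^nat)
    (c : nat -> \bar R) (w : T) (n : nat) :
  (forall n, 0 < A n) -> (forall i, c i = (mu i)%:E) ->
  centered_avg X a A c w n =
    ((\sum_(i < n.+1) a i * (X i w - mu i)) / A n)%:E.
Proof.
move=> A0 cE; rewrite /centered_avg inver gt_eqF// EFinM -sumEFin.
by congr (_ * _)%E; apply: eq_bigr => i _; rewrite cE.
Qed.

Lemma measurable_limn_esup_affine_sum (d : measure_display)
    (T : measurableType d) (R : realType) (X : nat -> {mfun T >-> R})
    (s mu A : R^nat) :
  measurable_fun setT (fun w => limn_esup
    (fun n => ((\sum_(i < n.+1) s i * (X i w - mu i)) / A n)%:E)).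
Proof.
apply: (measurable_fun_limn_esup (f := fun n w =>
  ((\sum_(i < n.+1) s i * (X i w - mu i)) / A n)%:E)) => n.
apply/measurable_EFinP; apply: measurable_funM => //.
apply: measurable_sum => i; apply: measurable_funM => //.
exact: measurable_funB.
Qed.

Unset Implicit Arguments.

Theorem theorem4p2 (d : measure_display) (T : measurableType d) (R : realType)
    (PP : set (probability T R)) (X : nat -> {mfun T >-> R})
    (alpha beta : R) (a A : nat -> R)
    (PP0 : PP !=set0)
    (NA : negatively_associated PP X)
    (alpha0 : 0 < alpha)
    (Xmoment : (ereal_sup (range (fun i : nat =>
       upper_expectation PP (fun w => `|X i w| `^ (alpha + 1))%R)) < +oo)%E)
    (a0 : forall i, 0 < a i)
    (abnd : bounded_fun a)
    (A0 : forall n, 0 < A n)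
    (Aincr : nondecreasing_seq A)
    (beta0 : 0 < beta)
    (beta1 : beta < Num.min 1 alpha)
    (Alim : (A n / n.+1%:R `^ (1 / (beta + 1))) @[n --> \oo] --> +oo) :
  let lowavg := centered_avg X a A (fun i => lower_expectation PP (X i)) in
  let upavg := centered_avg X a A (fun i => upper_expectation PP (X i)) in
  [/\ upper_prob PP ([set w | (limn_einf (lowavg w) < 0)%E] `|`
                     [set w | (limn_esup (upavg w) > 0)%E]) = 0%E,
      lower_prob PP [set w | (limn_einf (lowavg w) >= 0)%E] = 1%E &
      lower_prob PP [set w | (limn_esup (upavg w) <= 0)%E] = 1%E].
Proof.
have pE : 1 / (beta + 1) = (beta + 1)^-1 by rewrite div1r.
rewrite {}pE in Alim.
have p1q : 1 <= beta + 1 < Num.min 2 (alpha + 1).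
  move: beta1; rewrite !lt_min => /andP[b1 ba].
  by apply/and3P; split; lra.
have q1 : 1 <= alpha + 1 by lra.
(* If the supremum of the moments is -oo, then 0 is a bound as well. *)
have [M XM] : exists M, forall i P, PP P ->
    ('E_P[(fun w => `|X i w| `^ (alpha + 1))%R] <= M%:E)%E.
  have h i P : PP P -> ('E_P[(fun w => `|X i w| `^ (alpha + 1))%R] <=
      ereal_sup (range (fun i : nat =>
       upper_expectation PP (fun w => `|X i w| `^ (alpha + 1))%R)))%E.
    move=> PPP; apply: (le_trans (le_upper_expectation _ PPP)).
    by apply: ereal_sup_ubound; exists i.
  move: Xmoment h; case: ereal_sup => [M _ h|//|_ h]; first by exists M.
  by exists 0 => i P PPP; apply: (le_trans (h i P PPP)); rewrite leNye.
have [D aD] : exists D, forall i, `|a i| <= D.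
  have [D [_ aD]] := abnd; exists (D + 1) => i.
  by apply: (aD (D + 1)) => //; rewrite ltrDl.
pose m := 1 + M.
have Xm i P (PPP : PP P) : (`|'E_P[X i]| <= m%:E)%E.
  exact: abse_expectation_le q1 (XM i P PPP).
have Xm2 i P (PPP : PP P) : (- m%:E <= 'E_P[X i] <= m%:E)%E.
  by rewrite -lee_abs_EFin Xm.
have [P0 PP0'] := PP0.
have upB i : (`|upper_expectation PP (X i)| <= m%:E)%E.
  rewrite lee_abs_EFin; apply/andP; split.
    apply: (le_trans _ (le_upper_expectation _ PP0')).
    by have /andP[] := Xm2 i P0 PP0'.
  by apply: upper_expectation_le => P /(Xm2 i) /andP[].
have loB i : (`|lower_expectation PP (X i)| <= m%:E)%E.
  rewrite lee_abs_EFin; apply/andP; split.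
    by apply: le_ereal_inf_tmp => _ [P /(Xm2 i) /andP[? _] <-].
  apply: (@le_trans _ _ 'E_P0[X i]%E).
    by apply: ereal_inf_lbound; exists P0.
  by have /andP[] := Xm2 i P0 PP0'.
pose mu i := fine (upper_expectation PP (X i)).
pose nu i := fine (lower_expectation PP (X i)).
have muE i : upper_expectation PP (X i) = (mu i)%:E.
  rewrite /mu fineK// fin_num_abs; exact: le_lt_trans (upB i) (ltry _).
have nuE i : lower_expectation PP (X i) = (nu i)%:E.
  rewrite /nu fineK// fin_num_abs; exact: le_lt_trans (loB i) (ltry _).
have EX i P : PP P -> 'E_P[X i]%E \is a fin_num.
  move=> PPP; rewrite fin_num_abs; exact: le_lt_trans (Xm i P PPP) (ltry _).
(* Both events become the positivity of an upper limit of real averages. *)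
pose U w := limn_esup
  (fun n => ((\sum_(i < n.+1) a i * (X i w - mu i)) / A n)%:E).
pose L w := limn_esup
  (fun n => ((\sum_(i < n.+1) - a i * (X i w - nu i)) / A n)%:E).
move=> lowavg upavg.
have upE w : limn_esup (upavg w) = U w.
  congr limn_esup; apply/funext => n; exact: centered_avgE.
have loE w : limn_einf (lowavg w) = (- L w)%E.
  rewrite /limn_einf; congr (- limn_esup _)%E; apply/funext => n.
  rewrite /lowavg (centered_avgE _ _ _ _ A0 nuE) -EFinN -mulNr -sumrN.
  by under eq_bigr do rewrite -mulNr.
have aeU P : PP P -> {ae P, forall w, (U w <= 0)%E}.
  move=> PPP; apply: (ae_limn_esup_affine_sum_le0 (s := a) (mu := mu) (D := D)
    (m := m) PPP NA p1q XM) => //.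
  - by left => i; exact: ltW.
  - by move=> i; rewrite -lee_fin -abse_EFin -muE.
  - move=> i Q PPQ; rewrite pmulr_rle0// subr_le0 -lee_fin -muE fineK ?EX//.
    exact: le_upper_expectation.
have aeL P : PP P -> {ae P, forall w, (L w <= 0)%E}.
  move=> PPP; apply: (ae_limn_esup_affine_sum_le0 (s := fun i => - a i)
    (mu := nu) (D := D) (m := m) PPP NA p1q XM) => //.
  - by right => i; rewrite oppr_le0 ltW.
  - by move=> i; rewrite normrN.
  - by move=> i; rewrite -lee_fin -abse_EFin -nuE.
  - move=> i Q PPQ; rewrite mulNr oppr_le0 pmulr_rge0// subr_ge0.
    rewrite -lee_fin -nuE fineK ?EX//.
    by apply: ereal_inf_lbound; exists Q.
have -> : [set w | (limn_einf (lowavg w) < 0)%E] = [set w | (0 < L w)%E].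
  by apply/seteqP; split => w /=; rewrite loE oppe_lt0.
have -> : [set w | (limn_esup (upavg w) > 0)%E] = [set w | (0 < U w)%E].
  by apply/seteqP; split => w /=; rewrite upE.
have -> : [set w | (limn_einf (lowavg w) >= 0)%E] = ~` [set w | (0 < L w)%E].
  by apply/seteqP; split => w /=; rewrite loE oppe_ge0 leNgt => /negP.
have -> : [set w | (limn_esup (upavg w) <= 0)%E] = ~` [set w | (0 < U w)%E].
  by apply/seteqP; split => w /=; rewrite upE leNgt => /negP.
have pos_measurable (V : T -> \bar R) : measurable_fun setT V ->
    measurable [set w : T | (0 < V w)%E].
  move=> mV; rewrite -[X in measurable X]setTI.
  exact: emeasurable_fun_o_infty.
have null (V : T -> \bar R) (P : probability T R) : measurable_fun setT V -> {ae P, forall w, (V w <= 0)%E} ->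
    P [set w : T | (0 < V w)%E] = 0%E.
  move=> mV aeV; apply/(negligibleP P (pos_measurable V mV)).
  by apply: negligibleS aeV => w /= V0; apply/negP; rewrite -ltNge.
have mU : measurable_fun setT U := measurable_limn_esup_affine_sum X a mu A.
have mL : measurable_fun setT L :=
  measurable_limn_esup_affine_sum X (fun i => - a i) nu A.
have PU P : PP P -> P [set w | (0 < U w)%E] = 0%E.
  by move=> PPP; apply: null => //; exact: aeU.
have PL P : PP P -> P [set w | (0 < L w)%E] = 0%E.
  by move=> PPP; apply: null => //; exact: aeL.
split.
- apply: upper_prob_eq0 => // P PPP.
  by apply: null_set_setU; [exact: pos_measurable|exact: pos_measurable|
    exact: PL|exact: PU].
- apply: lower_prob_eq1 => // P PPP.
  by rewrite probability_setC ?PL ?sube0//; exact: pos_measurable.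
- apply: lower_prob_eq1 => // P PPP.
  by rewrite probability_setC ?PU ?sube0//; exact: pos_measurable.
Qed.
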